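(* Let $\mathcal A_+,\mathcal A_-\subseteq\mathbb Z^n$ be disjoint finite sets with $\mathcal A_-\subseteq\operatorname{relint}(\operatorname{conv}(\mathcal A_+))$ such that $(\mathcal A_+,\mathcal A_-)$ is nonseparable. Then $\mathcal C_{\mathrm{SONC}}(\mathcal A_+,\mathcal A_-)=\mathcal C(\mathcal A_+,\mathcal A_-)$; that is, every copositive real Laurent polynomial with signed support $(\mathcal A_+,\mathcal A_-)$ is a sum of copositive circuit signomials.
   Context: A signomial with signed support $(\mathcal A_+,\mathcal A_-)$ is $f(x)=\sum_{a\in\mathcal A_+}c_ax^a-\sum_{b\in\mathcal A_-}c_bx^b$ on $\mathbb R^n_{>0}$ with all $c_a,c_b>0$; $\mathcal S(\mathcal A_+,\mathcal A_-)$ is the set of these. Copositive means nonnegative on $\mathbb R^n_{>0}$. Let $d=\dim\operatorname{conv}(\mathcal A_+\cup\mathcal A_-)$; $\mathcal F(\mathcal A_+)$ is the common refinement of all regular polyhedral subdivisions of $\mathcal A_+$, $\mathcal F_d(\mathcal A_+)$ its $d$-cells; $(\mathcal A_+,\mathcal A_-)$ is nonseparable if $\mathcal A_-\subseteq\operatorname{relint}\operatorname{conv}(\mathcal A_+)$ and some $D\in\mathcal F_d(\mathcal A_+)$ contains $\mathcal A_-$. A signed support $(\mathcal B_+,\mathcal B_-)$ is a circuit if either $\#(\mathcal B_+\cup\mathcal B_-)=\#\mathcal B_+=1$, or $\operatorname{conv}(\mathcal B_+\cup\mathcal B_-)$ is a simplex with vertex set $\mathcal B_+$, $\#\mathcal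 B_-=1$ and $\mathcal B_-\subseteq\operatorname{relint}\operatorname{conv}(\mathcal B_+)$; a circuit signomial has circuit signed support. A signomial is SONC if it is a finite sum of copositive circuit signomials. $\mathcal C_{\mathrm{SONC}}(\mathcal A_+,\mathcal A_-)$ and $\mathcal C(\mathcal A_+,\mathcal A_-)$ are the SONC, resp. copositive, elements of $\mathcal S(\mathcal A_+,\mathcal A_-)$. *)

(* Defs.v *)
(* Points of R^n are row vectors 'rV[R]_n,
   R : realType. Finite sets of exponents are sequences (duplicates harmless). *)
From HB Require Import structures.
From mathcomp Require Import all_boot all_order all_algebra.
From mathcomp Require Import all_classical all_reals.
From mathcomp Require Import exp.
Set Implicit Arguments. Unset Strict Implicit. Unset Printing Implicit Defensive.
Import Order.TTheory GRing.Theory Num.Theory.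
Local Open Scope ring_scope.
Local Open Scope classical_set_scope.

Section Defs.
Variables (R : realType) (n : nat).
Notation pt := 'rV[R]_n.

Definition conv (s : seq pt) : set pt :=
  [set x | exists lam : 'I_(size s) -> R,
     (forall i, 0 <= lam i) /\ \sum_i lam i = 1 /\
     x = \sum_i lam i *: s`_i].

Definition aff (C : set pt) : set pt :=
  [set x | exists (k : nat) (p : 'I_k -> pt) (lam : 'I_k -> R),
     (forall i, C (p i)) /\ \sum_i lam i = 1 /\ x = \sum_i lam i *: p i].

Definition relint (C : set pt) : set pt :=
  [set x | C x /\ exists2 e : R, 0 < e &
     forall y, aff C y -> (forall i, `|y 0 i - x 0 i| < e) -> C y].

Definition aff_indep (k : nat) (p : 'I_k -> pt) : Prop :=
  forall lam : 'I_k -> R, \sum_i lam i = 0 -> \sum_i lam i *: p i = 0 ->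
    forall i, lam i = 0.

Definition aff_indep_seq (s : seq pt) : Prop :=
  aff_indep (fun i : 'I_(size (undup s)) => (undup s)`_i).

Definition has_affdim (C : set pt) (d : nat) : Prop :=
  (exists p : 'I_d.+1 -> pt, (forall i, C (p i)) /\ aff_indep p) /\
  (forall (k : nat) (p : 'I_k -> pt),
     (forall i, C (p i)) -> aff_indep p -> (k <= d.+1)%N).

Definition affine_fun (w : pt) (beta : R) (a : pt) : R :=
  \sum_i w 0 i * a 0 i + beta.

(* sigma is a cell of the regular subdivision of the point configuration A
   induced by the height function h : the projection of a lower face of the
   lifted configuration {(a, h a)}, i.e. conv of the points where some affine
   function lying weakly below h on A touches h *)
Definition reg_cell (A : seq pt) (h : pt -> R) (sigma : set pt) : Prop :=
  exists (w : pt) (beta : R),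
    (forall a, a \in A -> affine_fun w beta a <= h a) /\
    sigma = conv [seq a <- A | affine_fun w beta a == h a].

(* D is a cell of F(A), the common refinement of all regular subdivisions
   of A : an intersection of one cell from each regular subdivision *)
Definition refinement_cell (A : seq pt) (D : set pt) : Prop :=
  exists sigma : (pt -> R) -> set pt,
    (forall h, reg_cell A h (sigma h)) /\
    D = [set x | forall h, sigma h x].

Definition nonseparable (Ap Am : seq pt) : Prop :=
  (forall b, b \in Am -> relint (conv Ap) b) /\
  exists d : nat, has_affdim (conv (Ap ++ Am)) d /\
    exists D, [/\ refinement_cell Ap D, has_affdim D d &
                  forall b, b \in Am -> D b].

Definition pos_orthant (x : pt) : Prop := forall i, 0 < x 0 i.

(* x^a = prod_i x_i^(a_i) on the positive orthant (real exponents) *)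
Definition monom (x a : pt) : R := \prod_(i < n) (x 0 i) `^ (a 0 i).

Definition signomial_S (Ap Am : seq pt) : set (pt -> R) :=
  [set f | exists cp cm : pt -> R,
     (forall a, a \in Ap -> 0 < cp a) /\ (forall b, b \in Am -> 0 < cm b) /\
     forall x, pos_orthant x ->
       f x = \sum_(a <- Ap) cp a * monom x a - \sum_(b <- Am) cm b * monom x b].

Definition copositive (f : pt -> R) : Prop :=
  forall x, pos_orthant x -> 0 <= f x.

Definition circuit (Bp Bm : seq pt) : Prop :=
  (size (undup (Bp ++ Bm)) = 1%N /\ size (undup Bp) = 1%N) \/
  [/\ aff_indep_seq Bp, conv (Bp ++ Bm) = conv Bp,
      size (undup Bm) = 1%N & forall b, b \in Bm -> relint (conv Bp) b].

Definition circuit_signomial (f : pt -> R) : Prop :=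
  exists Bp Bm, circuit Bp Bm /\ signomial_S Bp Bm f.

Definition SONC (f : pt -> R) : Prop :=
  exists (k : nat) (g : 'I_k -> pt -> R),
    (forall j, circuit_signomial (g j) /\ copositive (g j)) /\
    forall x, pos_orthant x -> f x = \sum_j g j x.

Definition C_SONC (Ap Am : seq pt) : set (pt -> R) :=
  [set f | signomial_S Ap Am f /\ SONC f].

Definition C_cop (Ap Am : seq pt) : set (pt -> R) :=
  [set f | signomial_S Ap Am f /\ copositive f].

Definition int_pt (a : pt) : Prop := forall i, a 0 i \is a Num.int.

End Defs.

(* Main.v *)
(* In logarithmic coordinates write f = F - G with F, G the positive and negative
   exponential sums. Since A_- lies in the relative interior of conv A_+, F/G attains
   its minimum on the direction space of conv A_+, at a point y where the normalised
   terms of F and of G are probability measures on A_+ and A_- with equal barycentres.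
   Nonseparability is exactly what makes the transport problem "split the first measure
   into pieces with barycentre b, of the mass of b, for each b in A_-" feasible: a dual
   obstruction is a convex piecewise affine function, hence a height function on A_+,
   and it is affine on the cell containing A_-. Each piece is nonnegative by AM-GM at y,
   and splits into circuits by splitting its weights along affine dependences. *)
Require Import Defs.
From HB Require Import structures.
From mathcomp Require Import all_boot all_order all_algebra.
From mathcomp Require Import all_classical all_reals.
From mathcomp Require Import topology normedtype sequences derive exp.
From mathcomp Require Import ring lra.
Set Implicit Arguments. Unset Strict Implicit. Unset Printing Implicit Defensive.
Import Order.TTheory GRing.Theory Num.Theory.
Import numFieldNormedType.Exports.
Local Open Scope ring_scope.
Local Open Scope classical_set_scope.

(** * Farkas' lemma for finitely many linear forms *)

Section Farkas.
Variables (R : realFieldType) (W : lmodType R).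

Definition linear_form (f : W -> R) := forall c x y, f (c *: x + y) = c * f x + f y.

(* Bartl's induction: if the forms in [r] do not suffice, a point [x0] witnessing
   this gives a projection along [x0] onto the kernel of the remaining form. *)
Lemma farkas (I : eqType) (r : seq I) (al : I -> W -> R) (g : W -> R) :
  uniq r -> (forall i, linear_form (al i)) -> linear_form g ->
  (forall x, (forall i, i \in r -> al i x <= 0) -> g x <= 0) ->
  exists u : I -> R, (forall i, 0 <= u i) /\ forall x, g x = \sum_(i <- r) u i * al i x.
Proof.
elim: r al g => [|i0 r IH] al g /=.
  move=> _ _ lg H; exists (fun=> 0); split=> // x; rewrite big_nil.
  have g0 y : g y <= 0 by apply: H.
  have gD := lg (-1) x x.
  have := g0 x; have := g0 (-1 *: x + 0).
  have g00 := lg 1 0 0; rewrite scaler0 addr0 in g00.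
  rewrite lg; lra.
case/andP=> i0r ur lal lg H.
have [H1|/existsNP[x0 /not_implyP[Hx0 /negP]]] :=
    pselect (forall x, (forall i, i \in r -> al i x <= 0) -> g x <= 0).
  have [u [u0 gE]] := IH al g ur lal lg H1.
  exists (fun i => if i == i0 then 0 else u i); split=> [i|x]; first by case: ifP.
  rewrite big_cons eqxx mul0r add0r gE; apply: eq_big_seq => i ir.
  by case: eqP ir i0r => // -> ->.
rewrite -ltNge => gx0.
have ax0 : 0 < al i0 x0.
  rewrite ltNge; apply/negP => a0.
  have: g x0 <= 0.
    by apply: H => i; rewrite inE => /orP[/eqP->//|]; apply: Hx0.
  lra.
pose t := (al i0 x0)^-1.
have t0 : 0 < t by rewrite invr_gt0.
have ta : t * al i0 x0 = 1 by rewrite mulVf // gt_eqF.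
pose proj (f : W -> R) x := f (- (t * al i0 x) *: x0 + x).
have projE f x : linear_form f -> proj f x = f x - t * al i0 x * f x0.
  by move=> lf; rewrite /proj lf; ring.
have lproj f : linear_form f -> linear_form (proj f).
  by move=> lf c x y; rewrite !projE // lf lal; ring.
have [||//||u [u0 gE]] := IH (fun i => proj (al i)) (proj g).
- by [].
- by move=> i; apply: lproj.
- exact: lproj.
- move=> x Hx; apply: H => i; rewrite inE => /orP[/eqP->|/Hx//].
  rewrite -/(proj (al i0) x) projE //.
  suff -> : t * al i0 x * al i0 x0 = al i0 x by rewrite subrr.
  by rewrite mulrAC ta mul1r.
(* Comparing coefficients of [al i0] in the identity for the projected forms forces this value. It
   is nonnegative because [g x0 > 0] while the forms in [r] are nonpositive at [x0]. *)
pose c := t * (g x0 - \sum_(i <- r) u i * al i x0).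
exists (fun j => if j == i0 then c else u j); split=> [j|x].
  case: ifP => // _; rewrite mulr_ge0 ?(ltW t0)// subr_ge0.
  apply: (@le_trans _ _ 0) (ltW gx0).
  rewrite big_seq; apply: sumr_le0 => i ir.
  by rewrite mulr_ge0_le0 // Hx0.
rewrite big_cons eqxx.
have -> : \sum_(j <- r) (if j == i0 then c else u j) * al j x =
          \sum_(j <- r) u j * al j x.
  by apply: eq_big_seq => i ir; case: eqP ir i0r => // -> ->.
have := gE x; rewrite projE //.
under eq_bigr => i _ do rewrite projE // mulrBr mulrCA.
rewrite sumrB -mulr_sumr /c => /eqP; rewrite subr_eq => /eqP ->.
ring.
Qed.

End Farkas.

(** * The standard bilinear form *)

Section Dot.
Variables (R : comPzRingType) (n : nat).
Implicit Types u v w : 'rV[R]_n.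

Definition dot u v : R := \sum_i u 0 i * v 0 i.

Lemma dotC u v : dot u v = dot v u.
Proof. by apply: eq_bigr => i _; rewrite mulrC. Qed.

Lemma dotDl u v w : dot (u + v) w = dot u w + dot v w.
Proof. by rewrite -big_split; apply: eq_bigr => i _; rewrite mxE mulrDl. Qed.

Lemma dotZl c u v : dot (c *: u) v = c * dot u v.
Proof. by rewrite /dot mulr_sumr; apply: eq_bigr => i _; rewrite mxE mulrA. Qed.

Lemma dotNl u v : dot (- u) v = - dot u v.
Proof. by rewrite -scaleN1r dotZl mulN1r. Qed.

Lemma dotBl u v w : dot (u - v) w = dot u w - dot v w.
Proof. by rewrite dotDl dotNl. Qed.

Lemma dotDr u v w : dot u (v + w) = dot u v + dot u w.
Proof. by rewrite dotC dotDl !(dotC _ u). Qed.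

Lemma dotZr c u v : dot u (c *: v) = c * dot u v.
Proof. by rewrite dotC dotZl (dotC v). Qed.

Lemma dotBr u v w : dot u (v - w) = dot u v - dot u w.
Proof. by rewrite dotC dotBl !(dotC _ u). Qed.

Lemma dot0l v : dot 0 v = 0.
Proof. by rewrite -(scale0r 0) dotZl mul0r. Qed.

Lemma dot_suml (I : Type) (r : seq I) (F : I -> 'rV[R]_n) v :
  dot (\sum_(i <- r) F i) v = \sum_(i <- r) dot (F i) v.
Proof.
elim: r => [|i r IH]; first by rewrite !big_nil dot0l.
by rewrite !big_cons dotDl IH.
Qed.

End Dot.

(** * Splitting a measure into pieces with prescribed masses and barycentres *)

Section Coupling.
Variables (R : realType) (n : nat).
Notation pt := 'rV[R]_n.

Lemma affine_fun_comb (I : finType) (lam : I -> R) (p : I -> pt) w beta :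
  \sum_i lam i * affine_fun w beta (p i) =
  dot (\sum_i lam i *: p i) w + (\sum_i lam i) * beta.
Proof.
rewrite dot_suml mulr_suml -big_split; apply: eq_bigr => i _.
by rewrite dotZl mulrDr (dotC (p i)).
Qed.

Lemma affine_funE w beta (x : pt) : affine_fun w beta x = dot w x + beta.
Proof. by []. Qed.

(* In the dual of the transport problem the best potential on [A] is the convex piecewise affine
   function [h]; on the cell containing every [b j] it is interpolated by an
   affine function, against which both measures integrate equally. *)
Lemma martingale_coupling (A : seq pt) (k : nat) (b : 'I_k -> pt)
    (P : 'I_(size A) -> R) (Q : 'I_k -> R) (j0 : 'I_k) :
  (forall i, 0 <= P i) -> (forall j, 0 <= Q j) ->
  \sum_i P i = \sum_j Q j ->
  \sum_i P i *: A`_i = \sum_j Q j *: b j ->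
  (forall h, exists2 C, reg_cell A h C & forall j, C (b j)) ->
  exists K : 'I_(size A) -> 'I_k -> R,
    [/\ forall i j, 0 <= K i j, forall i, \sum_j K i j = P i,
        forall j, \sum_i K i j = Q j
      & forall j, \sum_i K i j *: A`_i = Q j *: b j].
Proof.
move=> P0 Q0 PQ PQb cell.
(* Dual variables of the transport problem: [x.1.1] for the masses [P], [x.1.2] for the masses [Q],
   row [j] of [x.2] for the barycentre of piece [j]. The Farkas multiplier of [al (i, j)] will be
   the mass that point [i] of [A] contributes to piece [j]. *)
pose W : lmodType R := ('rV[R]_(size A) * 'rV[R]_k * 'M[R]_(k, n))%type.
pose al (ij : 'I_(size A) * 'I_k) (x : W) : R :=
  - (x.1.1 0 ij.1 + x.1.2 0 ij.2 + dot (row ij.2 x.2) A`_(ij.1)).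
pose g (x : W) : R := - (\sum_i P i * x.1.1 0 i + \sum_j Q j * x.1.2 0 j
                         + \sum_j Q j * dot (row j x.2) (b j)).
have [||||] := @farkas R W _ (index_enum _) al g.
- exact: index_enum_uniq.
- move=> ij c x y; rewrite /al !linearP /= !mxE dotDl dotZl; ring.
- move=> c x y; rewrite /g.
  under eq_bigr do rewrite !mxE mulrDr mulrCA.
  rewrite big_split -mulr_sumr /=.
  under [X in _ + X + _]eq_bigr do rewrite !mxE mulrDr mulrCA.
  rewrite big_split -mulr_sumr /=.
  under [X in _ + X]eq_bigr do rewrite linearP dotDl dotZl mulrDr mulrCA.
  rewrite big_split -mulr_sumr /=; ring.
- move=> x Hx.
  (* The constraint for [(i, j)] says that [x.1.1 0 i] is at least [l j] at point [i] of [A], so [h]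
     is the least admissible potential. The default [l j0 y] keeps [h] a maximum of the [l j]
     alone. *)
  pose l j := affine_fun (- row j x.2) (- x.1.2 0 j).
  pose h y := \big[Num.max/l j0 y]_j l j y.
  have [_ [w [beta [wh ->]]] bC] := cell h.
  (* [l j] is affine and at most [h], and [b j] is an average of points at which the affine function
     of the cell equals [h]. *)
  have lb j : l j (b j) <= affine_fun w beta (b j).
    have [lam [lam0 [lam1 bE]]] := bC j.
    have E w' beta' : affine_fun w' beta' (b j) =
        \sum_i lam i * affine_fun w' beta'
          [seq a <- A | affine_fun w beta a == h a]`_i.
      by rewrite affine_fun_comb lam1 -bE mul1r dotC.
    rewrite /l !E; apply: ler_sum => i _; apply: ler_wpM2l => //.
    have := mem_nth 0 (ltn_ord i); rewrite mem_filter => /andP[/eqP-> _].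
    exact: le_bigmax.
  have hu (i : 'I_(size A)) : h A`_i <= x.1.1 0 i.
    have lu j : l j A`_i <= x.1.1 0 i.
      have := Hx (i, j) (mem_index_enum _).
      rewrite /l affine_funE /al dotNl /=; lra.
    by apply: bigmax_le => *; apply: lu.
  have s1 : \sum_i P i * affine_fun w beta A`_i <= \sum_i P i * x.1.1 0 i.
    apply: ler_sum => i _; apply: ler_wpM2l => //.
    by apply: le_trans (hu i); apply: wh; rewrite mem_nth.
  have s2 : \sum_j Q j * l j (b j) <= \sum_j Q j * affine_fun w beta (b j).
    by apply: ler_sum => j _; apply: ler_wpM2l.
  rewrite !affine_fun_comb PQ PQb in s1 s2.
  have s3 : \sum_j Q j * l j (b j) =
     - (\sum_j Q j * x.1.2 0 j + \sum_j Q j * dot (row j x.2) (b j)).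
    rewrite -big_split -sumrN; apply: eq_bigr => j _.
    rewrite /l affine_funE dotNl /=; ring.
  rewrite /g; rewrite s3 in s2; lra.
move=> u [u0 gE].
have pair (F : 'I_(size A) -> 'I_k -> R) :
  \sum_(ij : 'I_(size A) * 'I_k) F ij.1 ij.2 = \sum_i \sum_j F i j.
  by rewrite pair_big.
have gE' x : g x = \sum_i \sum_j u (i, j) * al (i, j) x.
  by rewrite gE -pair; apply: eq_bigr => -[].
(* Evaluating the identity at unit vectors of the three blocks of [W] reads off the row sums, the
   column sums and the barycentres. *)
exists (fun i j => u (i, j)); split=> // [i|j|j].
- have := gE' (delta_mx 0 i, 0, 0).
  rewrite /g /al /= (bigD1 i) //= big1 => [|i' ne]; last first.
    by rewrite !mxE eqxx (negPf ne) mulr0.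
  rewrite !mxE !eqxx mulr1 addr0.
  rewrite (big1 _ _ (fun j => Q j * _)) => [|j _]; last by rewrite mxE mulr0.
  rewrite big1 => [|j _]; last by rewrite row0 dot0l mulr0.
  rewrite !addr0 (bigD1 i) //= [X in _ + X]big1 => [|i' ne]; last first.
    by rewrite big1 // => j _; rewrite !mxE (negPf ne) row0 dot0l andbF !addr0 oppr0 mulr0.
  move/eqP; rewrite addr0.
  under eq_bigr do rewrite !mxE !eqxx row0 dot0l !addr0 mulrN1.
  by rewrite sumrN eqr_opp => /eqP.
- have := gE' (0, delta_mx 0 j, 0).
  rewrite /g /al /= big1 ?add0r => [|i _]; last by rewrite mxE mulr0.
  rewrite (bigD1 j) //= big1 => [|j' ne]; last first.
    by rewrite !mxE eqxx (negPf ne) mulr0.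
  rewrite !mxE !eqxx mulr1 addr0.
  rewrite big1 => [|j' _]; last by rewrite row0 dot0l mulr0.
  rewrite addr0 exchange_big (bigD1 j) //= [X in _ + X]big1 => [|j' ne]; last first.
    by rewrite big1 // => i _; rewrite !mxE (negPf ne) row0 dot0l andbF !addr0 oppr0 mulr0.
  move/eqP; rewrite addr0.
  under eq_bigr do rewrite !mxE !eqxx row0 dot0l !addr0 add0r mulrN1.
  by rewrite sumrN eqr_opp => /eqP.
- apply/rowP => q.
  have := gE' (0, 0, delta_mx j q).
  have dotd j' (z : pt) : dot (row j' (delta_mx j q)) z = (j' == j)%:R * z 0 q.
    rewrite /dot (bigD1 q) //= big1 => [|q' ne]; last first.
      by rewrite !mxE (negPf ne) andbF mul0r.
    by rewrite !mxE eqxx andbT addr0.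
  rewrite /g /al /= big1 ?add0r => [|i _]; last by rewrite mxE mulr0.
  rewrite big1 ?add0r => [|i _]; last by rewrite mxE mulr0.
  rewrite (bigD1 j) //= big1 => [|j' ne]; last by rewrite dotd (negPf ne) mul0r mulr0.
  rewrite dotd eqxx mul1r addr0 exchange_big (bigD1 j) //= [X in _ + X]big1 => [|j' ne]; last first.
    by rewrite big1 // => i _; rewrite !mxE dotd (negPf ne) mul0r !addr0 oppr0 mulr0.
  move/eqP; rewrite addr0.
  under eq_bigr do rewrite !mxE dotd eqxx mul1r !add0r mulrN.
  rewrite sumrN eqr_opp mxE => /eqP ->.
  by rewrite summxE; apply: eq_bigr => i _; rewrite mxE.
Qed.

End Coupling.

(** * Minimising a ratio of exponential sums *)

Section TightPoint.
Variables (R : realType) (n : nat).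
Notation pt := 'rV[R]_n.

Lemma continuous_dot (a : pt) : continuous (fun y : pt => dot a y).
Proof.
move=> y; apply: (@continuous_big _ _ _ _ _ _ _ (index_enum _)) => [|i _ {}y].
  exact: add_continuous.
by apply: continuousM; [exact: cst_continuous|exact: coord_continuous].
Qed.

Lemma closed_submx m (B : 'M[R]_(m, n)) : closed [set y : pt | (y <= B)%MS].
Proof.
have -> : [set y : pt | (y <= B)%MS] =
    \bigcap_(j in [set: 'I_n])
      ((fun y : pt => dot (col j (cokermx B))^T y) @^-1` [set x | x = 0]).
  apply/seteqP; split=> y /=.
    rewrite submxE => /eqP/rowP yB j _; have := yB j; rewrite !mxE; apply: etrans.
    by apply: eq_bigr => i _; rewrite !mxE mulrC.
  move=> yB; rewrite submxE; apply/eqP/rowP => j; rewrite !mxE; apply: etrans (yB j I).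
  by apply: eq_bigr => i _; rewrite !mxE mulrC.
apply: closed_bigI => j _; apply: preimage_closed; last exact: closed_eq.
by move=> y _; apply: continuous_dot.
Qed.

(** The direction space of the affine hull of the family [a]. *)
Definition dirspace m (a : 'I_m -> pt) : set pt :=
  [set y | exists2 mu : 'I_m -> R, \sum_i mu i = 0 & y = \sum_i mu i *: a i].

(** The coefficient vectors of sum zero form a kernel, and the matrix of points maps it onto the
    direction space, which is therefore a row space. *)
Lemma closed_dirspace m (a : 'I_m -> pt) : closed (dirspace a).
Proof.
pose B : 'M[R]_(m, n) := \matrix_i a i.
suff -> : dirspace a = [set y | (y <= kermx (const_mx 1 : 'cV_m) *m B)%MS].
  exact: closed_submx.
have rowB (v : 'rV_m) : v *m B = \sum_i v 0 i *: a i.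
  by rewrite mulmx_sum_row; apply: eq_bigr => i _; rewrite rowK.
have sum1 (v : 'rV[R]_m) : (v *m const_mx 1 : 'cV_1) 0 0 = \sum_i v 0 i.
  by rewrite mxE; apply: eq_bigr => i _; rewrite mxE mulr1.
apply/seteqP; split=> y /=.
  move=> [mu mu0 ->].
  have /submxP[D DE] : ((\row_i mu i) <= kermx (const_mx 1 : 'cV[R]_m))%MS.
    apply/sub_kermxP/matrixP => i j; rewrite !ord1 sum1 mxE -[RHS]mu0.
    by apply: eq_bigr => k _; rewrite mxE.
  apply/submxP; exists D; rewrite mulmxA -DE rowB.
  by apply: eq_bigr => i _; rewrite mxE.
move=> /submxP[D ->]; rewrite mulmxA.
exists (fun i => (D *m kermx (const_mx 1 : 'cV[R]_m)) 0 i); last by rewrite rowB.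
by rewrite -sum1 -mulmxA mulmx_ker mulmx0 mxE.
Qed.

Lemma dirspaceD m (a : 'I_m -> pt) x y c :
  dirspace a x -> dirspace a y -> dirspace a (x + c *: y).
Proof.
move=> [mu mu0 ->] [nu nu0 ->]; exists (fun i => mu i + c * nu i).
  by rewrite big_split -mulr_sumr /= mu0 nu0 mulr0 addr0.
rewrite scaler_sumr -big_split; apply: eq_bigr => i _.
by rewrite scalerDl scalerA.
Qed.

Lemma mem_conv (s : seq pt) (i : 'I_(size s)) : conv s s`_i.
Proof.
exists (fun j => (j == i)%:R); split=> [j|]; first exact: ler0n.
split; rewrite (bigD1 i) //= eqxx big1 ?addr0 ?scale1r // => j /negPf -> //.
by rewrite scale0r.
Qed.

(** If every point of [A] were strictly lower than [x], averaging would stay strict, since some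
    weight is positive. *)
Lemma conv_exists_ge (A : seq pt) x (y : pt) :
  conv A x -> exists i : 'I_(size A), dot x y <= dot A`_i y.
Proof.
move=> [lam [lam0 [lam1 ->]]]; apply: contrapT => /forallNP H.
have lt (i : 'I_(size A)) : dot A`_i y < dot (\sum_i lam i *: A`_i) y.
  by rewrite ltNge; apply/negP/H.
have [i0 li0] : exists i, 0 < lam i.
  apply: contrapT => /forallNP H0; suff : (1 : R) = 0 by move/eqP; rewrite oner_eq0.
  rewrite -lam1 big1 // => i _; apply/eqP; rewrite eq_le lam0 andbT leNgt.
  exact/negP/H0.
have : \sum_i lam i * dot A`_i y < \sum_i lam i * dot (\sum_i lam i *: A`_i) y.
  rewrite (bigD1 i0) //= [ltRHS](bigD1 i0) //=; apply: ltr_leD.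
    by rewrite ltr_pM2l.
  by apply: ler_sum => i _; rewrite ler_wpM2l // ltW.
rewrite -mulr_suml lam1 mul1r dot_suml.
by under eq_bigr do rewrite -dotZl; rewrite ltxx.
Qed.

Lemma dot_ge0 (y : pt) : 0 <= dot y y.
Proof. by apply: sumr_ge0 => i _; rewrite -expr2 sqr_ge0. Qed.

Lemma coord_le_sqrt_dot (y : pt) i : `|y 0 i| <= Num.sqrt (dot y y).
Proof.
rewrite -sqrtr_sqr ler_sqrt ?dot_ge0 // /dot (bigD1 i) //= -expr2 lerDl.
by apply: sumr_ge0 => j _; rewrite -expr2 sqr_ge0.
Qed.

(** A step of fixed length from [b] along [y] stays in the hull, and some point of [A] is at least
    as high as its end. The uniform gain [d] makes the ratio of exponential sums coercive. *)
Lemma relint_spread (A : seq pt) b : relint (conv A) b ->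
  exists2 d : R, 0 < d & forall y, dirspace (fun i : 'I_(size A) => A`_i) y ->
    exists i : 'I_(size A), dot b y + d * Num.sqrt (dot y y) <= dot A`_i y.
Proof.
move=> [[lam [_ [lam1 bE]]] [e e0 He]]; exists (e / 2); first by rewrite divr_gt0.
move=> y [mu mu0 yE].
set N := Num.sqrt (dot y y).
have N0 : 0 <= N by exact: sqrtr_ge0.
have NN : dot y y = N * N by rewrite -expr2 sqr_sqrtr // dot_ge0.
(* Scales [y] to length [e / 2]. For [y = 0], division by zero gives [s = 0] and the step
   vanishes. *)
pose s := e / 2 / N.
have s0 : 0 <= s by rewrite !divr_ge0 // ltW.
have sN : s * N <= e / 2.
  rewrite /s; have [->|Nn] := eqVneq N 0; first by rewrite mulr0 divr_ge0 // ltW.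
  by rewrite mulfVK.
have /conv_exists_ge : conv A (b + s *: y).
  apply: He => [|i].
    exists (size A), (fun i => A`_i), (fun i => lam i + s * mu i).
    split=> [i|]; first exact: mem_conv.
    split; first by rewrite big_split -mulr_sumr /= lam1 mu0 mulr0 addr0.
    rewrite bE yE scaler_sumr -big_split; apply: eq_bigr => i _.
    by rewrite scalerDl scalerA.
  rewrite !mxE addrAC subrr add0r normrM ger0_norm //.
  have := ler_wpM2l s0 (coord_le_sqrt_dot y i); rewrite -/N; lra.
move=> /(_ y)[i]; rewrite dotDl dotZl NN => Hi; exists i; apply: le_trans Hi.
rewrite lerD2l /s; have [->|Nn] := eqVneq N 0; first by rewrite !mulr0.
by rewrite mulrA mulfVK.
Qed.

(** Here [expR x <= (1 - x)^-1], and [(1 - x) * (1 + x + 2 * x ^+ 2) = 1 + x ^+ 2 * (1 - 2 * x)] is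
    at least 1. *)
Lemma expR_le_quad (x : R) : x <= 2^-1 -> expR x <= 1 + x + 2 * x ^+ 2.
Proof.
move=> x2; have x1 : 0 < 1 - x by lra.
have := expR_ge1Dx (- x); rewrite expRN => H.
have : expR x <= (1 - x)^-1 by rewrite -[expR x]invrK lef_pV2 // posrE ?invr_gt0 ?expR_gt0.
move=> /le_trans; apply; rewrite -[leLHS]mul1r ler_pdivrMr //.
have : 0 <= x ^+ 2 * (1 - 2 * x) by rewrite mulr_ge0 ?sqr_ge0 //; lra.
nra.
Qed.

Definition expsum m (c : 'I_m -> R) (a : 'I_m -> pt) (y : pt) : R :=
  \sum_i c i * expR (dot (a i) y).

Lemma expsum_gt0 m (c : 'I_m -> R) a y (i0 : 'I_m) :
  (forall i, 0 < c i) -> 0 < expsum c a y.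
Proof.
move=> c0; rewrite /expsum (bigD1 i0) //= ltr_wpDr //.
  by apply: sumr_ge0 => i _; rewrite mulr_ge0 ?expR_ge0 // ltW.
by rewrite mulr_gt0 ?expR_gt0.
Qed.

Lemma continuous_expsum m (c : 'I_m -> R) a : continuous (expsum c a).
Proof.
move=> y; apply: (@continuous_big _ _ _ _ _ _ _ (index_enum _)) => [|i _ {}y].
  exact: add_continuous.
apply: (@continuousM R pt (fun=> c i) (fun y => expR (dot (a i) y))).
  exact: cst_continuous.
apply: (@continuous_comp pt R R (fun y => dot (a i) y) expR).
  exact: continuous_dot.
exact: continuous_expR.
Qed.

(** By [relint_spread] each [b j] is outgrown by some point of [A], so the ratio grows at least
    linearly in the norm and the search reduces to a compact box. *)
Lemma expsum_ratio_min (A : seq pt) k (b : 'I_k -> pt) (c : 'I_(size A) -> R)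
    (q : 'I_k -> R) (j0 : 'I_k) :
  (forall i, 0 < c i) -> (forall j, 0 < q j) ->
  (forall j, relint (conv A) (b j)) ->
  let a := fun i : 'I_(size A) => A`_i in
  exists2 y0, dirspace a y0 & forall y, dirspace a y ->
    expsum c a y0 / expsum q b y0 <= expsum c a y / expsum q b y.
Proof.
move=> c0 q0 rb a.
have [i0 _] := conv_exists_ge 0 (rb j0).1.
have F0 y : 0 < expsum c a y by exact: expsum_gt0.
have G0 y : 0 < expsum q b y by exact: expsum_gt0.
pose rho y := expsum c a y / expsum q b y.
have rho0 y : 0 < rho y by rewrite divr_gt0.
have [d0 Hd0] : exists d0 : 'I_k -> R, forall j, 0 < d0 j /\ forall y, dirspace a y ->
    exists i, dot (b j) y + d0 j * Num.sqrt (dot y y) <= dot (a i) y.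
  suff /choice[d0 H] : forall j, exists d, 0 < d /\ forall y, dirspace a y ->
    exists i, dot (b j) y + d * Num.sqrt (dot y y) <= dot (a i) y by exists d0.
  by move=> j; have [d d_gt0 H] := relint_spread (rb j); exists d.
pose d := \big[Num.min/1]_j d0 j.
have d_gt0 : 0 < d by apply: lt_bigmin => // j _; case: (Hd0 j).
pose M := (\sum_i (c i)^-1) * \sum_j q j.
have M0 : 0 <= M.
  by rewrite mulr_ge0 ?sumr_ge0 // => i _; rewrite ?invr_ge0 ltW.
(* For each [j], [expR t] times the exponential of [b j] is at most the exponential of some [a i],
   hence at most [\sum_i (c i)^-1] times the numerator. Weighting by [q j] and summing produces
   [M]. *)
have coercive y : dirspace a y -> 1 + d * Num.sqrt (dot y y) <= M * rho y.
  move=> Wy; set t := d * _.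
  rewrite /rho mulrA ler_pdivlMr //.
  apply: (@le_trans _ _ (expR t * expsum q b y)).
    by rewrite ler_wpM2r ?expR_ge1Dx // ltW.
  have -> : M * expsum c a y = \sum_j q j * ((\sum_i (c i)^-1) * expsum c a y).
    by rewrite -mulr_suml /M; ring.
  rewrite mulr_sumr; apply: ler_sum => j _.
  rewrite mulrCA ler_wpM2l ?(ltW (q0 j)) // -expRD.
  have [i Hi] := (Hd0 j).2 y Wy.
  apply: (@le_trans _ _ (expR (dot (a i) y))).
    rewrite ler_expR addrC (le_trans _ Hi) // lerD2l ler_wpM2r ?sqrtr_ge0 //.
    exact: bigmin_le.
  rewrite -[leLHS](mulKf (lt0r_neq0 (c0 i))); apply: ler_pM.
  - by rewrite invr_ge0 ltW.
  - by rewrite mulr_ge0 ?expR_ge0 // ltW.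
  - by rewrite (bigD1 i) //= lerDl sumr_ge0 // => ? _; rewrite invr_ge0 ltW.
  - rewrite /expsum (bigD1 i) //= lerDl sumr_ge0 // => ? _.
    by rewrite mulr_ge0 ?expR_ge0 // ltW.
have W0 : dirspace a 0.
  exists (fun=> 0); first by rewrite big1.
  by rewrite big1 // => i _; rewrite scale0r.
(* Coercivity bounds the norm of [y] by [r] wherever [rho y <= rho 0]. *)
pose r := M * rho 0 / d.
pose box := [set y : pt | forall i, `[- r, r]%classic (y ord0 i)].
have cbox : compact (box `&` dirspace a).
  apply: compact_closedI; last exact: closed_dirspace.
  by apply: (@rV_compact R n (fun=> `[- r, r]%classic)) => i; apply: segment_compact.
have boxP y : dirspace a y -> rho y <= rho 0 -> box y.
  move=> Wy le i; rewrite /= in_itv /= -ler_norml.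
  apply: (le_trans (coord_le_sqrt_dot y i)).
  rewrite ler_pdivlMr // mulrC.
  by have := coercive y Wy; have := ler_wpM2l M0 le; lra.
have [||y0] := @EVT_min_rV R n rho _ _ cbox.
- by exists 0; split=> //; apply: boxP.
- apply: continuous_subspaceT => y.
  apply: (@continuousM R pt (expsum c a) (fun y => (expsum q b y)^-1)).
    exact: continuous_expsum.
  by apply: continuousV; [rewrite gt_eqF|exact: continuous_expsum].
rewrite inE => -[_ Wy0] Hmin; exists y0 => // y Wy.
have [le|/ltW le] := leP (rho y) (rho 0).
  by apply: Hmin; rewrite inE; split=> //; apply: boxP.
by apply: (le_trans _ le); apply: Hmin; rewrite inE; split=> //; apply: boxP.
Qed.

(* At a minimiser of the ratio of the two exponential sums over the direction
   space of [conv A], the logarithmic gradients agree. *)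
Lemma tight_point (A : seq pt) k (b : 'I_k -> pt) (c : 'I_(size A) -> R)
    (q : 'I_k -> R) (j0 : 'I_k) :
  (forall i, 0 < c i) -> (forall j, 0 < q j) ->
  (forall j, relint (conv A) (b j)) ->
  let a := fun i : 'I_(size A) => A`_i in
  exists y, \sum_i (c i * expR (dot (a i) y) / expsum c a y) *: a i =
            \sum_j (q j * expR (dot (b j) y) / expsum q b y) *: b j.
Proof.
move=> c0 q0 rb a.
have [y0 Wy0 Hmin] := expsum_ratio_min j0 c0 q0 rb; exists y0.
have [i0 _] := conv_exists_ge 0 (rb j0).1.
have F0 y : 0 < expsum c a y by exact: expsum_gt0.
have G0 y : 0 < expsum q b y by exact: expsum_gt0.
set F := expsum c a y0; set G := expsum q b y0.
have FF : 0 < F by exact: F0.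
have GG : 0 < G by exact: G0.
pose P i := c i * expR (dot (a i) y0) / F.
pose Q j := q j * expR (dot (b j) y0) / G.
have P0 i : 0 <= P i.
  exact: divr_ge0 (mulr_ge0 (ltW (c0 i)) (expR_ge0 _)) (ltW (F0 y0)).
have Q0 j : 0 <= Q j.
  exact: divr_ge0 (mulr_ge0 (ltW (q0 j)) (expR_ge0 _)) (ltW (G0 y0)).
have P1 : \sum_i P i = 1 by rewrite -mulr_suml; apply: divff; rewrite gt_eqF ?F0.
have Q1 : \sum_j Q j = 1 by rewrite -mulr_suml; apply: divff; rewrite gt_eqF ?G0.
(* The gap between the two barycentres lies in the direction space, so the minimiser may be varied
   along it. *)
pose g := \sum_i P i *: a i - \sum_j Q j *: b j.
suff: dot g g = 0.
  move=> g0; apply/eqP; rewrite -subr_eq0; apply/eqP/rowP => i.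
  have /(_ i isT) gi2 := psumr_eq0P (fun j _ => sqr_ge0 (g 0 j)) g0.
  have /eqP gi : g 0 i ^+ 2 == 0 by rewrite gi2.
  by move/eqP: gi; rewrite sqrf_eq0 => /eqP gi; rewrite [RHS]mxE.
have Wg : dirspace a g.
  have /choice[lam Hlam] j : exists lam : 'I_(size A) -> R,
      \sum_i lam i = 1 /\ b j = \sum_i lam i *: a i.
    by have [[lam [_ H]] _] := rb j; exists lam.
  exists (fun i => P i - \sum_j Q j * lam j i).
    rewrite sumrB exchange_big /= P1.
    under [X in _ - X]eq_bigr do rewrite -mulr_sumr (Hlam _).1 mulr1.
    by rewrite Q1 subrr.
  under eq_bigr do rewrite scalerBl scaler_suml.
  rewrite sumrB exchange_big /=; congr (_ - _); apply: eq_bigr => j _.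
  by rewrite {1}(Hlam j).2 scaler_sumr; apply: eq_bigr => i _; rewrite scalerA.
have key (s : R) : \sum_j Q j * expR (s * dot (b j) g) <= \sum_i P i * expR (s * dot (a i) g).
  have := Hmin _ (dirspaceD s Wy0 Wg).
  rewrite -/F -/G ler_pdivrMr // mulrAC ler_pdivlMr // => H.
  have EF : expsum c a (y0 + s *: g) = F * \sum_i P i * expR (s * dot (a i) g).
    rewrite mulr_sumr; apply: eq_bigr => i _; rewrite dotDr dotZr expRD /P.
    by field; rewrite gt_eqF.
  have EG : expsum q b (y0 + s *: g) = G * \sum_j Q j * expR (s * dot (b j) g).
    rewrite mulr_sumr; apply: eq_bigr => i _; rewrite dotDr dotZr expRD /Q.
    by field; rewrite gt_eqF.
  by move: H; rewrite EF EG mulrAC -mulrA !ler_pM2l.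
pose p := \sum_i P i * dot (a i) g; pose r := \sum_j Q j * dot (b j) g.
have gE : dot g g = p - r.
  by rewrite {1}/g dotBl !dot_suml; congr (_ - _); apply: eq_bigr => ? _; rewrite dotZl.
pose M := 1 + \sum_i `|dot (a i) g|.
have M1 : 1 <= M by rewrite lerDl sumr_ge0.
have aM i : `|dot (a i) g| <= M.
  rewrite /M (bigD1 i) //= addrCA lerDl addr_ge0 // sumr_ge0 //.
(* First-order optimality without derivatives: after a move by [- e *: g], tangent lines bound the
   [b] side from below and [expR_le_quad] bounds the [a] side from above. *)
have quad (e : R) : 0 <= e -> e * M <= 2^-1 -> e * dot g g <= 2 * (e * M) ^+ 2.
  move=> e0 eM.
  have lo : 1 - e * r <= \sum_j Q j * expR (- e * dot (b j) g).
    rewrite -[X in X - _]Q1 /r mulr_sumr -sumrB; apply: ler_sum => j _.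
    have := ler_wpM2l (Q0 j) (expR_ge1Dx (- e * dot (b j) g)); lra.
  have up : \sum_i P i * expR (- e * dot (a i) g) <= 1 - e * p + 2 * (e * M) ^+ 2.
    have -> : 1 - e * p + 2 * (e * M) ^+ 2 =
        \sum_i P i * (1 - e * dot (a i) g + 2 * (e * M) ^+ 2).
      transitivity ((\sum_i P i) - e * p + (\sum_i P i) * (2 * (e * M) ^+ 2)).
        by rewrite P1 mul1r.
      rewrite /p mulr_suml mulr_sumr -sumrB -big_split.
      by apply: eq_bigr => i _ /=; ring.
    apply: ler_sum => i _; apply: ler_wpM2l => //.
    have xM : `|- e * dot (a i) g| <= e * M.
      by rewrite normrM normrN (ger0_norm e0) ler_wpM2l.
    have x2 : - e * dot (a i) g <= 2^-1.
      exact: le_trans (ler_norm _) (le_trans xM eM).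
    apply: (le_trans (expR_le_quad x2)); rewrite mulNr.
    rewrite lerD2l ler_wpM2l // -[leLHS]real_normK ?num_real //.
    by rewrite -mulNr ler_pXn2r // ?nnegrE ?mulr_ge0 // (le_trans _ M1).
  rewrite gE; have := key (- e); lra.
apply/eqP; rewrite eq_le dot_ge0 andbT leNgt; apply/negP => D0.
set D := dot g g in quad D0.
(* Chosen so that [e * M] is below one half and [2 * (e * M) ^+ 2 = e * (M * D / (D + 2 * M))] is
   below [e * D], contradicting [quad]. *)
pose e := D / (2 * M * (D + 2 * M)).
have M0 : 0 < M by exact: lt_le_trans M1.
have S0 : 0 < D + 2 * M by lra.
have e0 : 0 < e by apply: divr_gt0 => //; do 2?apply: mulr_gt0.
have eM : e * M = D / (2 * (D + 2 * M)) by rewrite /e; field; rewrite !gt_eqF.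
have eM2 : e * M <= 2^-1 by rewrite eM ler_pdivrMr ?mulr_gt0 //; lra.
have := quad e (ltW e0) eM2; apply/negP; rewrite -ltNge.
have -> : 2 * (e * M) ^+ 2 = e * (M * (2 * (e * M))) by ring.
rewrite ltr_pM2l // eM.
have -> : M * (2 * (D / (2 * (D + 2 * M)))) = M * D / (D + 2 * M).
  by field; rewrite !gt_eqF.
rewrite ltr_pdivrMr //; nra.
Qed.

End TightPoint.

Section Mixtures.
Variables (R : realType) (n : nat).
Notation pt := 'rV[R]_n.

(** * Convex hulls and the relative interior of a simplex *)

Lemma conv_sub (s t : seq pt) : (forall p, p \in s -> conv t p) -> conv s `<=` conv t.
Proof.
move=> H x [lam [lam0 [lam1 ->]]].
have /choice[mu Hmu] (i : 'I_(size s)) : exists mu : 'I_(size t) -> R,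
    (forall j, 0 <= mu j) /\ \sum_j mu j = 1 /\ s`_i = \sum_j mu j *: t`_j.
  by apply: H; rewrite mem_nth.
exists (fun j => \sum_i lam i * mu i j); split=> [j|].
  by apply: sumr_ge0 => i _; rewrite mulr_ge0 //; case: (Hmu i).
split.
  rewrite exchange_big -[RHS]lam1; apply: eq_bigr => i _.
  by rewrite -mulr_sumr (Hmu i).2.1 mulr1.
under [RHS]eq_bigr do rewrite scaler_suml.
rewrite exchange_big; apply: eq_bigr => i _ /=.
by rewrite (Hmu i).2.2 scaler_sumr; apply: eq_bigr => j _; rewrite scalerA.
Qed.

Lemma aff_conv (s : seq pt) x : aff (conv s) x ->
  exists mu : 'I_(size s) -> R, \sum_j mu j = 1 /\ x = \sum_j mu j *: s`_j.
Proof.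
move=> [k [p [lam [Hp [lam1 ->]]]]].
have /choice[mu Hmu] i : exists mu : 'I_(size s) -> R,
    \sum_j mu j = 1 /\ p i = \sum_j mu j *: s`_j.
  by have [mu [_ H]] := Hp i; exists mu.
exists (fun j => \sum_i lam i * mu i j); split.
  rewrite exchange_big -[RHS]lam1; apply: eq_bigr => i _.
  by rewrite -mulr_sumr (Hmu i).1 mulr1.
under [RHS]eq_bigr do rewrite scaler_suml.
rewrite exchange_big; apply: eq_bigr => i _ /=.
by rewrite (Hmu i).2 scaler_sumr; apply: eq_bigr => j _; rewrite scalerA.
Qed.

Lemma conv_cat1 (s : seq pt) b : conv s b -> conv (s ++ [:: b]) = conv s.
Proof.
move=> sb; apply/seteqP; split; apply: conv_sub => p.
  rewrite mem_cat inE => /orP[/(nthP 0)[i lt <-]|/eqP-> //].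
  exact: (mem_conv (Ordinal lt)).
move=> ps; have : p \in s ++ [:: b] by rewrite mem_cat ps.
by move=> /(nthP 0)[i lt <-]; exact: (mem_conv (Ordinal lt)).
Qed.

(* Barycentric coordinates on an affinely independent family depend linearly,
   hence continuously, on the point. *)
Lemma relint_simplex (s : seq pt) (lam : 'I_(size s) -> R) :
  aff_indep (fun i : 'I_(size s) => s`_i) ->
  (forall i, 0 < lam i) -> \sum_i lam i = 1 ->
  relint (conv s) (\sum_i lam i *: s`_i).
Proof.
move=> indep lam0 lam1; split.
  by exists lam; split=> // i; rewrite ltW.
(* Appending a coordinate 1 turns affine into linear independence of the rows; a right inverse [B]
   then recovers barycentric coordinates. *)
pose M : 'M[R]_(size s, n + 1) := \matrix_i row_mx s`_i (const_mx 1).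
have rowM (v : 'rV_(size s)) :
    v *m M = row_mx (\sum_i v 0 i *: s`_i) (const_mx (\sum_i v 0 i)).
  rewrite mulmx_sum_row; under eq_bigr do rewrite rowK scale_row_mx.
  apply/rowP => k; rewrite summxE; case: (split_ordP k) => l ->.
    rewrite row_mxEl summxE; apply: eq_bigr => i _; by rewrite row_mxEl.
  rewrite row_mxEr mxE; apply: eq_bigr => i _.
  by rewrite row_mxEr !mxE mulr1.
have /row_freeP[B MB] : row_free M.
  apply: inj_row_free => v; rewrite rowM -row_mx0 => /eq_row_mx[v0 v1].
  apply/rowP => i; rewrite [RHS]mxE; apply: (indep (v 0)) => //.
  by have /rowP/(_ 0) := v1; rewrite !mxE.
(* A displacement below [l0 / S] in every coordinate changes each barycentric coordinate by at most
   [l0], the smallest weight capped at 1. The summand 1 keeps [S] positive. *)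
pose S := 1 + \sum_k \sum_i `|B k i|.
have S0 : 0 < S by rewrite ltr_wpDr // sumr_ge0 // => k _; rewrite sumr_ge0.
pose l0 := \big[Num.min/1]_i lam i.
have l00 : 0 < l0 by apply: lt_bigmin.
exists (l0 / S); first by rewrite divr_gt0.
move=> _ /aff_conv[mu [mu1 ->]] near.
set d := \sum_i mu i *: s`_i in near *; set b := \sum_i lam i *: s`_i in near.
exists mu; split=> // i.
have muE : mu i - lam i = \sum_k (d - b) 0 k * B (lshift 1 k) i.
  have : (\row_i (mu i - lam i)) *m M *m B = \row_i (mu i - lam i).
    by rewrite -mulmxA MB mulmx1.
  rewrite rowM => /rowP/(_ i); rewrite [RHS]mxE => <-.
  have sum0 : \sum_j (\row_i (mu i - lam i)) 0 j = 0.
    by under eq_bigr do rewrite mxE; rewrite sumrB mu1 lam1 subrr.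
  rewrite mxE big_split_ord /= big_ord1 row_mxEr mxE sum0 mul0r addr0.
  apply: eq_bigr => k _; rewrite row_mxEl; congr (_ 0 k * _).
  by under eq_bigr do rewrite mxE scalerBl; rewrite sumrB.
have : `|mu i - lam i| <= l0.
  rewrite muE; apply: (le_trans (ler_norm_sum _ _ _)).
  apply: (@le_trans _ _ (l0 / S * \sum_k \sum_i `|B k i|)).
    rewrite mulr_sumr [leRHS]big_split_ord /= -[leLHS]addr0; apply: lerD.
      apply: ler_sum => k _; rewrite normrM; apply: ler_pM => //.
        by rewrite !mxE ltW.
      by rewrite (bigD1 i) //= lerDl sumr_ge0.
    by apply: sumr_ge0 => k _; rewrite mulr_ge0 ?divr_ge0 ?sumr_ge0 // ltW.
  by rewrite -mulrA ger_pMr // ler_pdivrMl // mulr1 /S lerDr.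
have := bigmin_le 1 i lam; rewrite -/l0 ler_norml => ? /andP[]; lra.
Qed.

(** * Logarithmic coordinates and the cone of SONC functions *)

Definition lnv (x : pt) : pt := \row_i ln (x 0 i).

Definition expv (y : pt) : pt := \row_i expR (y 0 i).

Lemma monomE (x a : pt) : pos_orthant x -> monom x a = expR (dot a (lnv x)).
Proof.
move=> x0; rewrite /monom /dot /lnv.
elim/big_ind2: _ => [|u v u' v' -> ->|i _]; rewrite ?expR0 ?expRD //.
by rewrite /powR gt_eqF // mxE.
Qed.

Lemma monom_expv (y a : pt) : monom (expv y) a = expR (dot a y).
Proof.
rewrite monomE => [|i]; last by rewrite mxE expR_gt0.
by congr (expR _); apply: eq_bigr => i _; rewrite !mxE expRK.
Qed.

Implicit Types f g : pt -> R.

Lemma SONC_ext f g : (forall x, pos_orthant x -> f x = g x) -> SONC f -> SONC g.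
Proof.
by move=> fg [k [h [H E]]]; exists k, h; split=> // x x0; rewrite -fg // E.
Qed.

Lemma SONC0 : SONC (fun _ : pt => 0).
Proof. by exists 0%N, (fun=> fun=> 0); split=> [[]//|x _]; rewrite big_ord0. Qed.

Lemma SONC_circuit f : circuit_signomial f -> copositive f -> SONC f.
Proof. by move=> cf f0; exists 1%N, (fun=> f); split=> // x _; rewrite big_ord1. Qed.

Lemma SONCD f g : SONC f -> SONC g -> SONC (fun x => f x + g x).
Proof.
move=> [k [h [H E]]] [k' [h' [H' E']]].
exists (k + k')%N, (fun j : 'I_(k + k') =>
  match fintype.split j with inl i => h i | inr i => h' i end).
split=> [j|x x0]; first by case: (fintype.split j).
rewrite big_split_ord E // E' //; congr (_ + _); apply: eq_bigr => i _.
  by rewrite (unsplitK (inl i)).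
by rewrite (unsplitK (inr i)).
Qed.

Lemma SONC_sum (I : Type) (r : seq I) (F : I -> pt -> R) :
  (forall i, SONC (F i)) -> SONC (fun x => \sum_(i <- r) F i x).
Proof.
move=> H; elim: r => [|i r IH].
  by apply: SONC_ext SONC0 => x _; rewrite big_nil.
by apply: SONC_ext (SONCD (H i) IH) => x _; rewrite big_cons.
Qed.

(** Circuit signomials have strictly positive coefficients, so [c = 0] is handled apart, by the
    empty sum. *)
Lemma SONCZ c f : 0 <= c -> SONC f -> SONC (fun x => c * f x).
Proof.
rewrite le_eqVlt => /predU1P[<- _|c0].
  by apply: SONC_ext SONC0 => x _; rewrite mul0r.
move=> [k [g [H E]]]; exists k, (fun j x => c * g j x); split=> [j|x x0]; last first.
  by rewrite E // mulr_sumr.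
have [[Bp [Bm [circ [cp [cm [cp0 [cm0 gE]]]]]]] gj0] := H j.
split; last by move=> x x0; rewrite mulr_ge0 ?gj0 // ltW.
exists Bp, Bm; split=> //; exists (fun a => c * cp a), (fun b => c * cm b).
split=> [a /cp0|]; first exact: mulr_gt0.
split=> [b /cm0|x x0]; first exact: mulr_gt0.
rewrite gE // mulrBr !mulr_sumr.
by congr (_ - _); apply: eq_bigr => ? _; rewrite mulrA.
Qed.

Lemma SONC_monom (c : R) (a : pt) : 0 <= c -> SONC (fun x => c * monom x a).
Proof.
move=> c0; apply: SONCZ => //; apply: SONC_circuit => [|x _]; last first.
  by apply: prodr_ge0 => i _; exact: powR_ge0.
exists [:: a], [::]; split; first by left.
exists (fun=> 1), (fun=> 1); do 2![split=> //].
by move=> x _; rewrite big_seq1 big_nil subr0 mul1r.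
Qed.

(* The monomial [x^a] rescaled to take the value 1 at [expv y]. *)
Definition nmonom (y a x : pt) : R := expR (- dot a y) * monom x a.

Lemma nmonomE y a x : pos_orthant x -> nmonom y a x = expR (dot a (lnv x - y)).
Proof. by move=> x0; rewrite /nmonom monomE // -expRD dotBr addrC. Qed.

(** * AM-GM differences and their decomposition into circuits *)

Definition mixture (y b : pt) (K : pt -> R) (s : seq pt) (x : pt) : R :=
  \sum_(a <- s) K a * nmonom y a x - (\sum_(a <- s) K a) * nmonom y b x.

(** AM-GM by tangent lines: each exponential is bounded below by its tangent at the exponent of [b],
    and the barycentre condition cancels the linear terms. *)
Lemma mixture_copositive y b K s : (forall a, a \in s -> 0 <= K a) ->
  \sum_(a <- s) K a *: a = (\sum_(a <- s) K a) *: b ->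
  copositive (mixture y b K s).
Proof.
move=> K0 Kb x x0; rewrite subr_ge0 nmonomE //; set z := lnv x - y.
have -> : (\sum_(a <- s) K a) * expR (dot b z) =
    expR (dot b z) * \sum_(a <- s) K a * (1 + dot (a - b) z).
  rewrite mulrC; congr (_ * _).
  under [RHS]eq_bigr do rewrite dotBl mulrDr mulr1 mulrBr.
  rewrite big_split sumrB -mulr_suml /= -dotZl -Kb dot_suml.
  by under [X in _ + (_ - X)]eq_bigr do rewrite dotZl; rewrite subrr addr0.
rewrite mulr_sumr big_seq [leRHS]big_seq; apply: ler_sum => a sa.
rewrite nmonomE // mulrCA ler_wpM2l ?K0 //.
have -> : dot a (lnv x - y) = dot b z + dot (a - b) z by rewrite dotBl [RHS]addrC subrK.
by rewrite expRD ler_wpM2l ?expR_ge0 // expR_ge1Dx.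
Qed.

Lemma mixture_shift y b K nu (t e : R) s x :
  mixture y b (fun a => K a + t * (e * nu a)) s x =
  mixture y b K s x + t * e * mixture y b nu s x.
Proof.
rewrite /mixture; under eq_bigr do rewrite mulrDl -!mulrA.
by rewrite !big_split -!mulr_sumr /=; ring.
Qed.

(** Dividing the weights by their total gives [b] positive barycentric coordinates, so
    [relint_simplex] applies. *)
Lemma circuit_mixture (b : pt) K (s : seq pt) : uniq s -> aff_indep_seq s -> s != [::] ->
  (forall a, a \in s -> 0 < K a) ->
  \sum_(a <- s) K a *: a = (\sum_(a <- s) K a) *: b ->
  circuit s [:: b].
Proof.
move=> us indep s0 K0 Kb.
have S0 : 0 < \sum_(a <- s) K a.
  case: s s0 K0 {us indep Kb} => // a s _ K0; rewrite big_cons ltr_pwDl ?K0 ?mem_head //.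
  by rewrite big_seq sumr_ge0 // => c cs; rewrite ltW // K0 // inE cs orbT.
set S := \sum_(a <- s) K a in Kb S0.
have rb : relint (conv s) b.
  have -> : b = \sum_(i < size s) (K s`_i / S) *: s`_i.
    apply: (scalerI (lt0r_neq0 S0)); rewrite -Kb scaler_sumr (big_nth 0) big_mkord.
    by apply: eq_bigr => i _; rewrite scalerA mulrC mulfVK // gt_eqF.
  apply: relint_simplex.
  - by move: indep; rewrite /aff_indep_seq undup_id.
  - by move=> i; rewrite divr_gt0 // K0 // mem_nth.
  - rewrite -mulr_suml.
    have -> : \sum_(i < size s) K s`_i = S by rewrite /S (big_nth 0) big_mkord.
    by rewrite divff // gt_eqF.
right; split=> //; first by rewrite conv_cat1 //; case: rb.
by move=> c; rewrite inE => /eqP ->.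
Qed.

(** Exponent lists may repeat entries; merging the weights of equal entries turns weights on
    positions into weights on points. *)
Lemma sum_undup (V : lmodType R) (s : seq pt) (mu : 'I_(size s) -> R) (G : pt -> V) :
  \sum_(a <- undup s) (\sum_(i < size s | s`_i == a) mu i) *: G a =
  \sum_(i < size s) mu i *: G s`_i.
Proof.
under eq_bigr do rewrite scaler_suml.
rewrite (exchange_big_dep xpredT) //=; apply: eq_bigr => i _.
rewrite (big_rem s`_i) ?mem_undup ?mem_nth //= eqxx.
rewrite big_seq_cond big_pred0 ?addr0 // => a.
rewrite mem_rem_uniq ?undup_uniq // inE eq_sym.
by case: (s`_i == a) => //=; rewrite andbF.
Qed.

Lemma not_aff_indep_seq (s : seq pt) : uniq s -> ~ aff_indep_seq s -> exists nu : pt -> R,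
  [/\ \sum_(a <- s) nu a = 0, \sum_(a <- s) nu a *: a = 0
    & exists2 a, a \in s & nu a != 0].
Proof.
move=> us; rewrite /aff_indep_seq undup_id // => /existsNP[mu].
move=> /not_implyP[mu0 /not_implyP[mua /existsNP[i0 mui]]].
exists (fun a => \sum_(i < size s | s`_i == a) mu i); split.
- have := sum_undup mu (fun=> 1 : R^o); rewrite undup_id // => E.
  rewrite -[RHS]mu0; under [RHS]eq_bigr do rewrite -[mu _]mulr1.
  by rewrite -E; apply: eq_bigr => a _; rewrite [RHS]mulr1.
- by have := sum_undup mu id; rewrite undup_id // => ->.
- exists s`_i0; first by rewrite mem_nth.
  rewrite (big_pred1 i0); first exact/eqP.
  by move=> i; rewrite /= nth_uniq.
Qed.

(** The ratio test of Carathéodory's theorem. Maximising the depletion rate [F] makes entries with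
    [nu >= 0] harmless, their rate being nonpositive. *)
Lemma exhaust_weights (s : seq pt) (K nu : pt -> R) a1 :
  (forall a, a \in s -> 0 < K a) -> a1 \in s -> nu a1 < 0 ->
  exists2 t, 0 < t & (forall a, a \in s -> 0 <= K a + t * nu a) /\
    exists2 a, a \in s & K a + t * nu a = 0.
Proof.
move=> K0 /(nthP 0)[i1 lt1 <-] nu1.
pose F (i : 'I_(size s)) := - nu s`_i / K s`_i.
have Ks (i : 'I_(size s)) : 0 < K s`_i by rewrite K0 // mem_nth.
case: (@Order.TotalTheory.arg_maxP _ R _ (Ordinal lt1) xpredT F isT) => i _ Hi.
have Fi : 0 < F i.
  by apply: lt_le_trans (Hi (Ordinal lt1) isT); rewrite divr_gt0 ?oppr_gt0 // Ks.
have Fnu (j : 'I_(size s)) : nu s`_j = - (F j * K s`_j).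
  by rewrite /F mulfVK ?opprK // gt_eqF.
exists (F i)^-1; first by rewrite invr_gt0.
split=> [_ /(nthP 0)[j ltj <-]|]; last first.
  exists s`_i; first by rewrite mem_nth.
  by rewrite Fnu mulrN mulKf ?subrr // gt_eqF.
have := Fnu (Ordinal ltj) => /= ->.
rewrite mulrN mulrA subr_ge0 ger_pMl ?(Ks (Ordinal ltj)) //.
by rewrite ler_pdivrMl // mulr1; exact: (Hi (Ordinal ltj)).
Qed.

Lemma sum_pos_support (V : nmodType) (s : seq pt) (K : pt -> R) (H : pt -> V) :
  (forall a, a \in s -> 0 <= K a) -> (forall a, K a = 0 -> H a = 0) ->
  \sum_(a <- [seq a <- s | 0 < K a]) H a = \sum_(a <- s) H a.
Proof.
move=> K0 H0; rewrite big_filter big_mkcond big_seq [RHS]big_seq.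
apply: eq_bigr => a sa; case: ltP => // Ka.
by rewrite H0 //; apply/eqP; rewrite eq_le Ka K0.
Qed.

Lemma mixture_pos_support y b K s x : (forall a, a \in s -> 0 <= K a) ->
  mixture y b K [seq a <- s | 0 < K a] x = mixture y b K s x.
Proof.
by move=> K0; rewrite /mixture !sum_pos_support // => a ->; rewrite mul0r.
Qed.

(* Moving along an affine dependence in both directions writes the weights as a
   convex combination of weights with smaller supports. *)
Lemma SONC_mixture y b K s : uniq s -> (forall a, a \in s -> 0 < K a) ->
  \sum_(a <- s) K a *: a = (\sum_(a <- s) K a) *: b ->
  SONC (mixture y b K s).
Proof.
have [m] := ubnP (size s); elim: m K s => // m IH K s; rewrite ltnS => sm us K0 Kb.
have [->|s0] := eqVneq s [::].
  by apply: SONC_ext SONC0 => x _; rewrite /mixture !big_nil mul0r subr0.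
have [indep|dep] := pselect (aff_indep_seq s).
  apply: SONC_circuit; last by apply: mixture_copositive => // a /K0/ltW.
  exists s, [:: b]; split; first exact: (@circuit_mixture b K).
  exists (fun a => K a * expR (- dot a y)).
  exists (fun=> (\sum_(a <- s) K a) * expR (- dot b y)).
  split=> [a sa|]; first by rewrite mulr_gt0 ?expR_gt0 ?K0.
  split=> [c _|x _].
    rewrite mulr_gt0 ?expR_gt0 //.
    case: s s0 K0 {IH sm us Kb indep} => // a s _ K0.
    rewrite big_cons ltr_pwDl ?K0 ?mem_head //.
    by rewrite big_seq sumr_ge0 // => d ds; rewrite ltW // K0 // inE ds orbT.
  rewrite big_seq1 /mixture mulrA; congr (_ - _).
  by apply: eq_bigr => a _; rewrite mulrA.
have [nu [nu0 nua [a0 sa0 nua0]]] := not_aff_indep_seq us dep.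
(* [nu] sums to zero without vanishing on [s], so it takes both signs there. *)
have neg (eps : R) : eps != 0 -> exists2 a, a \in s & eps * nu a < 0.
  move=> eps0; apply: contrapT => H.
  have ge a : a \in s -> 0 <= eps * nu a.
    by move=> sa; rewrite leNgt; apply/negP => lt; apply: H; exists a.
  have : \sum_(a <- s) eps * nu a == 0 by rewrite -mulr_sumr nu0 mulr0.
  rewrite big_seq psumr_eq0 => [|a]; last exact: ge.
  move=> /allP/(_ a0 sa0); rewrite sa0 /= mulf_eq0 (negPf eps0) (negPf nua0).
  by [].
have half (eps : R) : eps != 0 -> exists2 t, 0 < t &
    SONC (mixture y b (fun a => K a + t * (eps * nu a)) s).
  move=> /neg[a1 sa1 nu1].
  have [t t0 [Kt [a2 sa2 Kt0]]] := @exhaust_weights s K (fun a => eps * nu a) a1 K0 sa1 nu1.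
  exists t => //; set K' := fun a => _ in Kt Kt0 *.
  apply: (@SONC_ext (mixture y b K' [seq a <- s | 0 < K' a])) => [x _|].
    exact: mixture_pos_support.
  apply: IH.
  - apply: leq_trans sm; rewrite size_filter -(count_predC (fun a => 0 < K' a) s).
    rewrite -[ltnLHS]addn0 ltn_add2l -has_count; apply/hasP; exists a2 => //=.
    by rewrite /K' Kt0 ltxx.
  - exact: filter_uniq.
  - by move=> a; rewrite mem_filter => /andP[].
  - rewrite !sum_pos_support // => [|a ->]; last by rewrite scale0r.
    have -> : \sum_(a <- s) K' a = \sum_(a <- s) K a.
      by rewrite big_split -!mulr_sumr /= nu0 !mulr0 addr0.
    rewrite -Kb; under eq_bigr do rewrite scalerDl mulrA -scalerA.
    by rewrite big_split -scaler_sumr /= nua scaler0 addr0.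
have [t t0 St] := half 1 (oner_neq0 _).
have [|u u0 Su] := half (-1); first by rewrite oppr_eq0 oner_neq0.
have tu0 : 0 < t + u by rewrite addr_gt0.
(* The weights [u / (t + u)] and [t / (t + u)] cancel the shifts by [t] along [nu] and by [u] along
   its opposite. *)
apply: (SONC_ext _ (SONCD (@SONCZ (u / (t + u)) _ _ St)
                          (@SONCZ (t / (t + u)) _ _ Su))) => [x _||].
- by rewrite !mixture_shift; field; rewrite gt_eqF.
- by rewrite divr_ge0 // ltW.
- by rewrite divr_ge0 // ltW.
Qed.

(** Merges repeated points and drops zero weights, as [SONC_mixture] requires. *)
Lemma SONC_atom y (b : pt) (A : seq pt) (K : 'I_(size A) -> R) :
  (forall i, 0 <= K i) ->
  \sum_i K i *: A`_i = (\sum_i K i) *: b ->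
  SONC (fun x => \sum_i K i * nmonom y A`_i x - (\sum_i K i) * nmonom y b x).
Proof.
move=> K0 Kb; pose nu a := \sum_(i < size A | A`_i == a) K i.
have nu0 a : a \in undup A -> 0 <= nu a by move=> _; apply: sumr_ge0.
have nuM (G : pt -> R) : \sum_(a <- undup A) nu a * G a = \sum_i K i * G A`_i.
  exact: (@sum_undup R^o A K G).
have nu1 : \sum_(a <- undup A) nu a = \sum_i K i.
  by have := nuM (fun=> 1); under eq_bigr do rewrite mulr1; move=> ->;
     under eq_bigr do rewrite mulr1.
apply: (@SONC_ext (mixture y b nu [seq a <- undup A | 0 < nu a])) => [x _|].
  by rewrite mixture_pos_support // /mixture nuM nu1.
apply: SONC_mixture.
- by rewrite filter_uniq ?undup_uniq.
- by move=> a; rewrite mem_filter => /andP[].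
- rewrite !sum_pos_support // => [|a ->]; last by rewrite scale0r.
  by rewrite nu1 -Kb; exact: (sum_undup K id).
Qed.

(** * Assembly of the decomposition *)

Lemma copositive_SONC (Ap Am : seq pt) f :
  (forall b, b \in Am -> relint (conv Ap) b) ->
  (forall h, exists2 C, reg_cell Ap h C & forall b, b \in Am -> C b) ->
  signomial_S Ap Am f -> copositive f -> SONC f.
Proof.
move=> rAm cell [cp [cm [cp0 [cm0 fE]]]] f0.
case: (posnP (size Am)) => [/size0nil Am0|Am0].
  rewrite Am0 in fE.
  apply: (@SONC_ext (fun x => \sum_(i < size Ap) cp Ap`_i * monom x Ap`_i)) => [x x0|].
    by rewrite fE // big_nil subr0 [RHS](big_nth 0) big_mkord.
  by apply: SONC_sum => i; apply: SONC_monom; rewrite ltW // cp0 // mem_nth.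
pose j0 := Ordinal Am0.
pose a (i : 'I_(size Ap)) := Ap`_i; pose b (j : 'I_(size Am)) := Am`_j.
pose c i := cp (a i); pose q j := cm (b j).
have c0 i : 0 < c i by rewrite cp0 // mem_nth.
have q0 j : 0 < q j by rewrite cm0 // mem_nth.
have rb j : relint (conv Ap) (b j) by apply: rAm; rewrite mem_nth.
have [i0 _] := conv_exists_ge 0 (rb j0).1.
have [y yE] := tight_point j0 c0 q0 rb.
have FF := expsum_gt0 a y i0 c0; have GG := expsum_gt0 b y j0 q0.
set F := expsum c a y in FF; set G := expsum q b y in GG.
pose P i := c i * expR (dot (a i) y) / F.
pose Q j := q j * expR (dot (b j) y) / G.
have P0 i : 0 <= P i := divr_ge0 (mulr_ge0 (ltW (c0 i)) (expR_ge0 _)) (ltW FF).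
have Q0 j : 0 <= Q j := divr_ge0 (mulr_ge0 (ltW (q0 j)) (expR_ge0 _)) (ltW GG).
have P1 : \sum_i P i = 1 by rewrite -mulr_suml; apply: divff; rewrite gt_eqF.
have Q1 : \sum_j Q j = 1 by rewrite -mulr_suml; apply: divff; rewrite gt_eqF.
have [||h|] := @martingale_coupling _ _ Ap _ b P Q j0 P0 Q0.
- by rewrite P1 Q1.
- exact: yE.
- have [C regC AmC] := cell h; exists C => // j; apply: AmC; exact: mem_nth.
move=> K [K0 KP KQ Kb].
have fE' x : pos_orthant x ->
    f x = \sum_i c i * monom x (a i) - \sum_j q j * monom x (b j).
  by move=> x0; rewrite fE //; congr (_ - _); rewrite (big_nth 0) big_mkord.
(* Copositivity enters only here, through the value of [f] at the tight point [expv y]. *)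
have GF : G / F <= 1.
  rewrite ler_pdivrMr // mul1r -subr_ge0.
  have pos : pos_orthant (expv y) by move=> i; rewrite mxE expR_gt0.
  have := f0 _ pos; rewrite fE' //.
  by under eq_bigr do rewrite monom_expv; under [X in _ - X]eq_bigr do rewrite monom_expv.
(* The fraction [G / F] of the positive part balances the whole negative part and is split by the
   coupling [K]; the rest is a sum of monomials. *)
apply: (@SONC_ext (fun x => \sum_i (c i * (1 - G / F)) * monom x (a i) +
    G * \sum_j (\sum_i K i j * nmonom y Ap`_i x - (\sum_i K i j) * nmonom y (b j) x))).
- move=> x x0; rewrite fE' // sumrB exchange_big /= mulrBr.
  have -> : G * \sum_i \sum_j K i j * nmonom y Ap`_i x =
      \sum_i c i * (G / F) * monom x (a i).
    rewrite mulr_sumr; apply: eq_bigr => i _; rewrite -mulr_suml KP /nmonom expRN /P.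
    by rewrite -/(a i); field; rewrite !gt_eqF ?expR_gt0.
  have -> : G * \sum_j (\sum_i K i j) * nmonom y (b j) x = \sum_j q j * monom x (b j).
    rewrite mulr_sumr; apply: eq_bigr => j _; rewrite KQ /nmonom expRN /Q.
    by field; rewrite !gt_eqF ?expR_gt0.
  rewrite addrA -big_split; congr (_ - _); apply: eq_bigr => i _ /=; ring.
- apply: SONCD.
    apply: SONC_sum => i; apply: SONC_monom.
    by rewrite mulr_ge0 ?subr_ge0 // ltW.
  apply: SONCZ; first exact: ltW.
  apply: SONC_sum => j; apply: SONC_atom => //.
  by rewrite Kb KQ.
Qed.

Lemma SONC_copositive f : SONC f -> copositive f.
Proof.
by move=> [k [g [H E]]] x x0; rewrite E // sumr_ge0 // => j _; apply: (H j).2.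
Qed.

End Mixtures.

Theorem theorem3p15 (R : realType) (n : nat) (Ap Am : seq 'rV[R]_n) :
  (forall a, a \in Ap -> int_pt a) ->
  (forall b, b \in Am -> int_pt b) ->
  (forall a, a \in Ap -> a \notin Am) ->
  (forall b, b \in Am -> relint (conv Ap) b) ->
  nonseparable Ap Am ->
  C_SONC Ap Am = C_cop Ap Am.
Proof.
move=> _ _ _ rAm [_ [d [_ [D [[sigma [regsigma DE]] _ DAm]]]]].
apply/seteqP; split=> f [Sf]; first by move=> /SONC_copositive.
move=> f0; split=> //; apply: (copositive_SONC rAm _ Sf f0) => h.
(* [D] lies in [sigma h] for every [h], so one cell of each regular subdivision contains all
   negative exponents. *)
by exists (sigma h) => // b /DAm; rewrite DE; apply.
Qed.
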